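(* Let $A=(P,V,\mathit{inp},\mathit{out})$ be an architecture, let $p\in P$ be a single process, and let $\varphi=\varphi_1\wedge\dots\wedge\varphi_n$ be a prioritized LTL specification over $V$. Then one can construct a parity tree automaton (over the unary binary encoding of assumption trees described in the context) such that the trees accepted by the automaton are exactly the dominant strategy annotated assumption trees of $p$.
   Context: An architecture is a tuple $A=(P,V,\mathit{inp},\mathit{out})$ where $P$ is a finite set of processes, $V$ a finite set of Boolean variables, and $\mathit{inp},\mathit{out}:P\to 2^V$ assign to each process disjoint sets of input and output variables, with outputs of distinct processes disjoint; variables that are outputs of no process are external inputs and are inputs of every process. A prioritized specification is a conjunction $\varphi=\varphi_1\wedge\dots\wedge\varphi_n$ of LTL formulas over $V$, $\varphi_1$ the most important; a computation (infinite sequence of valuations of $V$) $\sigma$ satisfies $\varphi$ up to priority $k$ if $\sigma\models\bigwedge_{i\le k}\varphi_i$. An assumption tree for process $p$ is a subtree (prefix-closed set of nodes) of the full tree with directions $\mathbb N\cup 2^{V\setminus\mathit{out}(p)}$ in which, on every path, directions alternate between a natural number and an element of $2^{V\setminus\mathit{out}(p)}$ (starting with a natural number). Intuitively a number is a promise by the environment restricting its future behaviour and the subsequent valuations are the execution of the promise. A strategy annotation of an assumption tree labels every node reached by a natural-number edge with an output value in $2^{\mathit{out}(p)}$. Along any infinite path of the tree (an alternating sequence of natural numbers and valuations of $V\setminus\mathit{out}(p)$), the annotation yields a computation by combining, at each step, the annotated output at the node reached by the number with the environment valuation on the following edge. A strategy annotation $t$ is dominated by a strategy annotation $s$ of the same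 tree, $t\preceq s$, iff for every such path present in the tree, if the computation resulting from $t$ satisfies $\varphi$ up to priority $m$, then the computation resulting from $s$ satisfies $\varphi$ up to some priority $n'\ge m$. An annotation $s$ is dominant if $t\preceq s$ for all annotations $t$; a dominant strategy annotated assumption tree is an assumption tree together with a dominant strategy annotation. Since assumption trees have infinite branching, they are represented for tree automata via the unary encoding of $\mathbb N^*$ in $\mathbb B^*$, where $abc\ldots\in\mathbb N^*$ is encoded as $0^a10^b10^c1\ldots$ (and partial trees are embedded into full trees by a Boolean label marking present nodes). A parity tree automaton is an alternating tree automaton with a coloring of states by natural numbers, accepting a run tree when on every path the highest color occurring infinitely often is even. *)

(* Defs.v *)
From HB Require Import structures.
From mathcomp Require Import all_boot.

Set Implicit Arguments.
Unset Strict Implicit.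
Unset Printing Implicit Defensive.

Record architecture := Architecture {
  proc : finType;
  var : finType;
  inp : proc -> {set var};
  out : proc -> {set var};
  inp_out_disjoint : forall p, [disjoint inp p & out p];
  out_disjoint : forall p q, p != q -> [disjoint out p & out q];
  external_inp : forall v, (forall q, v \notin out q) -> forall p, v \in inp p
}.

(* An element of 2^W is the set of variables of W that are true. *)
Definition valuation (V : finType) (W : {set V}) : finType :=
  {S : {set V} | S \subset W}.

Inductive ltl (V : Type) :=
| LTrue
| LVar of V
| LNot of ltl V
| LOr of ltl V & ltl V
| LNext of ltl V
| LUntil of ltl V & ltl V.

Definition computation (V : finType) := nat -> {set V}.

Fixpoint ltl_sat_at (V : finType) (sigma : computation V) (f : ltl V) (i : nat)
    : Prop :=
  match f with
  | LTrue => True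
  | LVar v => v \in sigma i
  | LNot g => ~ ltl_sat_at sigma g i
  | LOr g h => ltl_sat_at sigma g i \/ ltl_sat_at sigma h i
  | LNext g => ltl_sat_at sigma g i.+1
  | LUntil g h =>
      exists j, [/\ i <= j, ltl_sat_at sigma h j &
                    forall k, i <= k < j -> ltl_sat_at sigma g k]
  end.

Definition ltl_sat (V : finType) (sigma : computation V) (f : ltl V) : Prop :=
  ltl_sat_at sigma f 0.

(* The conjunct of priority i + 1 is tnth phi i. *)
Definition sat_upto (V : finType) (n : nat) (phi : n.-tuple (ltl V))
    (sigma : computation V) (k : nat) : Prop :=
  forall i : 'I_n, i < k -> ltl_sat sigma (tnth phi i).

Definition envval (A : architecture) (p : proc A) : finType :=
  valuation (~: out p).

Definition outval (A : architecture) (p : proc A) : finType :=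
  valuation (out p).

Definition adir (A : architecture) (p : proc A) : Type := (nat + envval p)%type.

Definition anode (A : architecture) (p : proc A) : Type := seq (adir p).

(* num tells whether the next direction must be a number. *)
Fixpoint alternating (A : architecture) (p : proc A) (num : bool)
    (v : anode p) : bool :=
  match v with
  | [::] => true
  | inl _ :: v' => num && alternating false v'
  | inr _ :: v' => ~~ num && alternating true v'
  end.

Definition assumption_tree (A : architecture) (p : proc A)
    (T : pred (anode p)) : Prop :=
  (forall u v, T (u ++ v) -> T u) /\ (forall v, T v -> alternating true v).

Definition number_node (A : architecture) (p : proc A) (v : anode p) : bool :=
  if v is d :: v' then (if last d v' is inl _ then true else false) else false.

(* An annotation of T is a function on all nodes of which only the values at
   the number nodes of T are ever used (in computations and in encodings). *)
Definition annotation (A : architecture) (p : proc A) : Type :=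
  anode p -> outval p.

(* The infinite path a_0 e_0 a_1 e_1 ... is given as i |-> (a_i, e_i). *)
Definition apath (A : architecture) (p : proc A) : Type :=
  nat -> nat * envval p.

Definition path_even (A : architecture) (p : proc A) (pi : apath p) (i : nat)
    : anode p :=
  flatten (mkseq (fun j => [:: inl (pi j).1; inr (pi j).2]) i).

Definition path_odd (A : architecture) (p : proc A) (pi : apath p) (i : nat)
    : anode p :=
  rcons (path_even pi i) (inl (pi i).1).

Definition path_in (A : architecture) (p : proc A) (T : pred (anode p))
    (pi : apath p) : Prop :=
  forall i, T (path_even pi i) /\ T (path_odd pi i).

Definition path_computation (A : architecture) (p : proc A) (s : annotation p)
    (pi : apath p) : computation (var A) :=
  fun i => val (s (path_odd pi i)) :|: val (pi i).2.

Definition dominated (A : architecture) (p : proc A) (n : nat)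
    (phi : n.-tuple (ltl (var A))) (T : pred (anode p)) (t s : annotation p)
    : Prop :=
  forall pi, path_in T pi ->
  forall m, 0 < m <= n -> sat_upto phi (path_computation t pi) m ->
  exists n', m <= n' <= n /\ sat_upto phi (path_computation s pi) n'.

Definition dominant (A : architecture) (p : proc A) (n : nat)
    (phi : n.-tuple (ltl (var A))) (T : pred (anode p)) (s : annotation p)
    : Prop :=
  forall t, dominated phi T t s.

(* Numbers are encoded in unary over the bits; valuations of the environment,
   which are finitely many, remain single directions. *)
Definition bdir (A : architecture) (p : proc A) : finType :=
  (bool + envval p)%type.

Definition code_dir (A : architecture) (p : proc A) (d : adir p)
    : seq (bdir p) :=
  match d with
  | inl a => rcons (nseq a (inl false)) (inl true)
  | inr e => [:: inr e]
  end.

Definition code (A : architecture) (p : proc A) (v : anode p) : seq (bdir p) :=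
  flatten (map (@code_dir A p) v).

(* The Boolean marks the present nodes; the second component carries the
   output exactly at the annotated nodes. *)
Definition label (A : architecture) (p : proc A) : finType :=
  (bool * option (outval p))%type.

Definition encodes (A : architecture) (p : proc A) (T : pred (anode p))
    (s : annotation p) (t : seq (bdir p) -> label p) : Prop :=
  (forall v, t (code v) =
     (T v, if T v && number_node v then Some (s v) else None)) /\
  (forall w, (forall v, w <> code v) -> t w = (false, None)).

Inductive posbool (X : Type) :=
| PTrue
| PFalse
| PAtom of X
| PAnd of posbool X & posbool X
| POr of posbool X & posbool X.

Fixpoint posbool_sat (X : Type) (S : X -> Prop) (f : posbool X) : Prop :=
  match f with
  | PTrue => True
  | PFalse => False
  | PAtom x => S x
  | PAnd g h => posbool_sat S g /\ posbool_sat S h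
  | POr g h => posbool_sat S g \/ posbool_sat S h
  end.

Record parity_automaton (D L : finType) := ParityAutomaton {
  state : finType;
  init : state;
  delta : state -> L -> posbool (D * state);
  color : state -> nat
}.

(* A run tree is a nonempty prefix-closed R over nat^*, a node y of which is
   labelled with a state and with the node of the input tree it is reading. *)
Definition run_tree (D L : finType) (M : parity_automaton D L)
    (t : seq D -> L) (R : seq nat -> Prop)
    (r : seq nat -> state M * seq D) : Prop :=
  [/\ R [::],
      forall y c, R (rcons y c) -> R y,
      r [::] = (init M, [::]) &
      forall y, R y ->
        (forall c, R (rcons y c) ->
           exists d q, r (rcons y c) = (q, rcons (r y).2 d)) /\
        posbool_sat
          (fun dq => exists c,
             R (rcons y c) /\ r (rcons y c) = (dq.2, rcons (r y).2 dq.1))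
          (delta (r y).1 (t (r y).2))].

(* c is the highest color occurring infinitely often. *)
Definition parity_condition (col : nat -> nat) : Prop :=
  exists c, [/\ ~~ odd c,
                forall N, exists i, N <= i /\ col i = c &
                exists N, forall i, N <= i -> col i <= c].

Definition accepts (D L : finType) (M : parity_automaton D L)
    (t : seq D -> L) : Prop :=
  exists R r, @run_tree D L M t R r /\
    forall b : nat -> nat, (forall i, R (mkseq b i)) ->
      parity_condition (fun i => color (r (mkseq b i)).1).

(* Main.v *)
Require Import Defs.
From HB Require Import structures.
From mathcomp Require Import all_boot boolp.

Set Implicit Arguments.
Unset Strict Implicit.
Unset Printing Implicit Defensive.

(* A path visits nodes of distinct sizes, so along a fixed path the outputs of a
   rival annotation are arbitrary. Dominance of s thus says that, for every path
   of the tree and every sequence of outputs, the pair of computations given by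
   these outputs and by s avoids an LTL-definable violation over two copies of
   the variables. The violations, outputs guessed, are recognized by a
   nondeterministic Büchi automaton (a tableau of the formula); its dual is a
   universal co-Büchi automaton, which needs no determinization to be run along
   all branches of a tree. It also checks that the tree is an encoding. *)

Definition infinitely_often (P : nat -> Prop) : Prop :=
  forall N, exists2 i, N <= i & P i.

(** * Universal automata *)

Section Universal.
Variables (D L Q : finType) (q0 : Q) (ok : Q -> L -> bool).
Variables (next : Q -> L -> D -> Q -> bool) (col : Q -> nat).

(** The conjunction ranges over all allowed successors, so a run tree has to follow every one of
    them. *)
Definition univ_delta (q : Q) (l : L) : posbool (D * Q) :=
  if ok q l then
    foldr (@PAnd _) (@PTrue _)
      [seq PAtom dq | dq <- enum [pred dq : D * Q | next q l dq.1 dq.2]]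
  else @PFalse _.

Definition univ_automaton : parity_automaton D L :=
  ParityAutomaton q0 univ_delta col.

Lemma univ_deltaP (S : D * Q -> Prop) q l :
  posbool_sat S (univ_delta q l) <->
  ok q l /\ forall d q', next q l d q' -> S (d, q').
Proof.
rewrite /univ_delta; case: ifP => _; last by split=> // -[].
have sat_foldr (s : seq (D * Q)) :
    posbool_sat S (foldr (@PAnd _) (@PTrue _) [seq PAtom dq | dq <- s]) <->
    forall dq, dq \in s -> S dq.
  elim: s => [|x s IHs] //=; split=> [[Sx /IHs Ss] y|Ss].
    by rewrite inE => /predU1P[->|/Ss].
  split; first by apply: Ss; rewrite mem_head.
  by apply/IHs => y ys; apply: Ss; rewrite inE ys orbT.
split=> [/sat_foldr Sn|[_ Sn]].
  by split=> // d q' nq; apply: Sn; rewrite mem_enum.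
by apply/sat_foldr => -[d q']; rewrite mem_enum => /Sn.
Qed.

Variable t : seq D -> L.

Fixpoint trace_from (q : Q) (u : seq D) (tau : seq (D * Q)) : bool :=
  if tau is (d, q') :: tau' then
    next q (t u) d q' && trace_from q' (rcons u d) tau'
  else true.

Definition trace := trace_from q0 [::].
Definition trace_state (tau : seq (D * Q)) : Q := last q0 (unzip2 tau).

Lemma trace_from_rcons q u tau d q' :
  trace_from q u (rcons tau (d, q')) =
  trace_from q u tau &&
    next (last q (unzip2 tau)) (t (u ++ unzip1 tau)) d q'.
Proof.
elim: tau q u => [|[e r] tau IHtau] q u /=; first by rewrite cats0 andbT.
by rewrite IHtau cat_rcons andbA.
Qed.

Lemma trace_rcons tau d q' :
  trace (rcons tau (d, q')) =
  trace tau && next (trace_state tau) (t (unzip1 tau)) d q'.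
Proof. exact: trace_from_rcons. Qed.

Definition infinite_trace (w : nat -> D) (q : nat -> Q) : Prop :=
  q 0 = q0 /\ forall i, next (q i) (t (mkseq w i)) (w i) (q i.+1).

(** Transitions being conjunctive, each finite trace is followed by some node of the run tree, by
    induction on the trace. *)
Lemma accepts_traces_ok :
  accepts univ_automaton t ->
  forall tau, trace tau -> ok (trace_state tau) (t (unzip1 tau)).
Proof.
move=> [R [r [[R0 _ r0 Rr] _]]].
have tauR tau : trace tau ->
    exists2 y, R y & r y = (trace_state tau, unzip1 tau).
  elim/last_ind: tau => [|tau [d q'] IHtau]; first by exists [::].
  rewrite trace_rcons => /andP[/IHtau[y Ry ry] nq].
  have [_] := Rr _ Ry; rewrite ry => /univ_deltaP[_ /(_ _ _ nq)[c [Rc rc]]].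
  exists (rcons y c) => //.
  by rewrite rc /trace_state /unzip1 /unzip2 !map_rcons last_rcons.
move=> tau /tauR[y Ry ry]; have [_] := Rr _ Ry.
by rewrite ry => /univ_deltaP[].
Qed.

Lemma accepts_traces_parity :
  accepts univ_automaton t ->
  forall w q, infinite_trace w q -> parity_condition (fun i => col (q i)).
Proof.
move=> [R [r [[R0 _ r0 Rr] Rpar]]] w q [q_0 qS].
(* At each time and node a child following the trace is chosen; 0 is the default at nodes off the
   trace. Iterating [g] from the root gives a branch labelled by the whole trace. *)
have /choice[g gP] : forall iy : nat * seq nat, exists c : nat,
    R iy.2 -> r iy.2 = (q iy.1, mkseq w iy.1) ->
    R (rcons iy.2 c) /\ r (rcons iy.2 c) = (q iy.1.+1, mkseq w iy.1.+1).
  move=> [i y] /=; have [[Ry ry]|nRy] := pselect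
    (R y /\ r y = (q i, mkseq w i)); last by exists 0 => Ry ry; case: nRy.
  have [_] := Rr _ Ry; rewrite ry => /univ_deltaP[_ /(_ _ _ (qS i))[c [Rc rc]]].
  by exists c => _ _; split; rewrite // rc mkseqS.
pose y := fix y i := if i is j.+1 then rcons (y j) (g (j, y j)) else [::].
have yP i : R (y i) /\ r (y i) = (q i, mkseq w i).
  by elim: i => [|i [Ry ry]]; [rewrite q_0 | exact: (gP (i, y i))].
pose b i := g (i, y i).
have yE i : mkseq b i = y i.
  by elim: i => //= i IHi; rewrite mkseqS IHi.
have := Rpar b; rewrite (_ : (fun i => _) = fun i => col (q i)).
  by apply=> i; rewrite yE; have [] := yP i.
by apply/funext => i /=; rewrite yE (yP i).2.
Qed.

(** The accepting run tree consists of all finite traces, each step being turned into a natural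
    number by [pickle]. *)
Lemma traces_accepts :
  (forall tau, trace tau -> ok (trace_state tau) (t (unzip1 tau))) ->
  (forall w q, infinite_trace w q -> parity_condition (fun i => col (q i))) ->
  accepts univ_automaton t.
Proof.
move=> trace_ok trace_par.
pose dec (y : seq nat) : seq (D * Q) := pmap unpickle y.
pose R y := exists2 tau, trace tau & y = map pickle tau.
pose r y := (trace_state (dec y), unzip1 (dec y)).
have decK tau : dec (map pickle tau) = tau by apply: map_pK; exact: pickleK.
have R_rcons y c : R (rcons y c) -> exists tau d q', [/\ y = map pickle tau,
    c = pickle (d, q') & trace (rcons tau (d, q'))].
  move=> [tau]; case/lastP: tau => [_|tau [d q'] tr]; first by case: y.
  by rewrite map_rcons => /rcons_inj[-> ->]; exists tau, d, q'.
exists R, r; split; first split.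
- by exists [::].
- move=> y c /R_rcons[tau [d [q' [-> _]]]].
  by rewrite trace_rcons => /andP[tr _]; exists tau.
- by [].
- move=> y Ry; split.
    move=> c /R_rcons[tau [d [q' [-> -> _]]]]; exists d, q'.
    rewrite /r -map_rcons !decK.
    by rewrite /trace_state /unzip1 /unzip2 !map_rcons last_rcons.
  case: Ry => tau tr ->; rewrite /r decK.
  apply/univ_deltaP; split=> [|d q' nq]; first exact: trace_ok.
  exists (pickle (d, q')); rewrite -map_rcons decK; split.
    by exists (rcons tau (d, q')); rewrite // trace_rcons tr.
  by rewrite /trace_state /unzip1 /unzip2 !map_rcons last_rcons.
(* Every direction of a branch is a pickled step, so the branch decodes to an infinite trace. *)
move=> b Rb.
have /choice[dq dqP] : forall i, exists dq, b i = pickle (dq : D * Q).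
  move=> i; have := Rb i.+1; rewrite mkseqS => /R_rcons[tau [d [q' [_ -> _]]]].
  by exists (d, q').
have decb i : dec (mkseq b i) = mkseq dq i.
  by rewrite -[RHS]decK -map_comp; congr dec; apply: eq_map => j /=.
have tr i : trace (mkseq dq i).
  by have [tau tr e] := Rb i; rewrite -decb e decK.
apply: (trace_par (fun i => (dq i).1)); split=> // i.
have := tr i.+1; rewrite /r !decb mkseqS; case: (dq i) => [d q'].
rewrite trace_rcons => /andP[_].
by rewrite {3}/trace_state /unzip1 /unzip2 !map_rcons last_rcons -map_comp.
Qed.

End Universal.

(** With colors 0 and 1 only, parity becomes the co-Büchi condition. *)
Lemma parity_bool (b : nat -> bool) :
  parity_condition (fun i => b i : nat) <-> ~ infinitely_often b.
Proof.
split=> [[c [c_even c_inf [N c_max]]] b_inf|nb].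
  have [i Ni bi] := b_inf N; have := c_max i Ni; rewrite bi.
  have [j [_ bj]] := c_inf 0; rewrite -bj in c_even *.
  by case: (b j) c_even.
have [N bN] : exists N, forall i, N <= i -> ~~ b i.
  apply: contrapT => nN; apply: nb => N; apply: contrapT => nbN; apply: nN.
  by exists N => i Ni; apply/negP => bi; apply: nbN; exists i.
exists 0; split=> // [M|].
  by exists (maxn M N); rewrite leq_maxl (negPf (bN _ _)) // leq_maxr.
by exists N => i /bN; case: (b i).
Qed.

(** * From LTL to Büchi automata *)

Section Tableau.
Variable V : finType.

(* A tableau guesses the truth value of every subformula. Each until also has
   a bit recording whether it was not pending at some time since the last
   reset; a reset takes place whenever all these bits are set. *)
Fixpoint tab (f : ltl V) : finType :=
  match f with
  | LTrue => unit
  | LVar _ => bool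
  | LNot g => tab g
  | LOr g h => (tab g * tab h)%type
  | LNext g => (bool * tab g)%type
  | LUntil g h => (bool * bool * (tab g * tab h))%type
  end.

Fixpoint tab_val (f : ltl V) : tab f -> bool :=
  match f return tab f -> bool with
  | LTrue => fun _ => true
  | LVar _ => fun x => x
  | LNot g => fun x => ~~ @tab_val g x
  | LOr g h => fun x => tab_val x.1 || tab_val x.2
  | LNext g => fun x => x.1
  | LUntil g h => fun x => x.1.1
  end.

Fixpoint tab_done (f : ltl V) : tab f -> bool :=
  match f return tab f -> bool with
  | LTrue => fun _ => true
  | LVar _ => fun _ => true
  | LNot g => fun x => @tab_done g x
  | LOr g h => fun x => tab_done x.1 && tab_done x.2
  | LNext g => fun x => tab_done x.2
  | LUntil g h => fun x => [&& x.1.2, tab_done x.2.1 & tab_done x.2.2]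
  end.

Fixpoint tab_reads (a : {set V}) (f : ltl V) : tab f -> bool :=
  match f return tab f -> bool with
  | LTrue => fun _ => true
  | LVar v => fun x => x == (v \in a)
  | LNot g => fun x => @tab_reads a g x
  | LOr g h => fun x => tab_reads a x.1 && tab_reads a x.2
  | LNext g => fun x => tab_reads a x.2
  | LUntil g h => fun x => tab_reads a x.2.1 && tab_reads a x.2.2
  end.

Fixpoint tab_step (reset : bool) (f : ltl V) : tab f -> tab f -> bool :=
  match f return tab f -> tab f -> bool with
  | LTrue => fun _ _ => true
  | LVar _ => fun _ _ => true
  | LNot g => fun x x' => @tab_step reset g x x'
  | LOr g h => fun x x' => tab_step reset x.1 x'.1 && tab_step reset x.2 x'.2
  | LNext g => fun x x' => (x.1 == tab_val x'.2) && tab_step reset x.2 x'.2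
  | LUntil g h => fun x x' =>
      [&& x.1.1 == tab_val x.2.2 || tab_val x.2.1 && x'.1.1,
          x'.1.2 == [|| ~~ reset && x.1.2, ~~ x'.1.1 | tab_val x'.2.2],
          tab_step reset x.2.1 x'.2.1 & tab_step reset x.2.2 x'.2.2]
  end.

(** * Soundness of fair tableau runs *)

Section Soundness.
Variables (sigma : computation V) (reset : nat -> bool).
Hypothesis reset_inf : infinitely_often reset.

(** After a reset only [fair] can set [done] again. Were [fair] false from then on, [done] would
    still be false at the next reset, which requires it. *)
Lemma until_done_fair (done fair : nat -> bool) :
  (forall i, done i.+1 = (~~ reset i && done i) || fair i.+1) ->
  (forall i, reset i -> done i) -> infinitely_often fair.
Proof.
move=> doneS reset_done N; have [i Ni ri] := reset_inf N.
have [j ij rj] := reset_inf i.+1.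
apply: contrapT => nfair.
suff notdone k : ~~ done (i.+1 + k).
  by have := notdone (j - i.+1); rewrite subnKC // reset_done.
have nfk m : i < m -> fair m = false.
  move=> im; apply/negP => fm; apply: nfair; exists m => //.
  exact: leq_trans Ni (ltnW im).
elim: k => [|k IHk]; first by rewrite addn0 doneS ri /= nfk.
by rewrite addnS doneS (negPf IHk) andbF nfk // ltnS ltnW // leq_addr.
Qed.

Lemma tab_sound (f : ltl V) (x : nat -> tab f) :
  (forall i, tab_reads (sigma i) (x i)) ->
  (forall i, tab_step (reset i) (x i) (x i.+1)) ->
  (forall i, reset i -> tab_done (x i)) ->
  forall i, tab_val (x i) <-> ltl_sat_at sigma f i.
Proof.
elim: f x => [|v|g IHg|g IHg h IHh|g IHg|g IHg h IHh] x xr xs xd i //=.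
- by have /eqP -> := xr i.
- have {}IHg := IHg x xr xs xd i.
  by split=> [/negP nx /IHg|nx] //; apply/negP => /IHg.
- have {}IHg := IHg (fun i => (x i).1); have {}IHh := IHh (fun i => (x i).2).
  have IHgi: tab_val (x i).1 <-> ltl_sat_at sigma g i.
    apply: IHg => j; first by have /andP[] := xr j.
      by have /andP[] := xs j.
    by move=> /xd /andP[].
  have IHhi: tab_val (x i).2 <-> ltl_sat_at sigma h i.
    apply: IHh => j; first by have /andP[] := xr j.
      by have /andP[] := xs j.
    by move=> /xd /andP[].
  by rewrite -IHgi -IHhi; split=> /orP.
- have {}IHg := IHg (fun i => (x i).2).
  have /andP[/eqP -> _] := xs i; apply: IHg => j; first exact: xr j.
    by have /andP[] := xs j.
  exact: xd.
have IHgi j : tab_val (x j).2.1 <-> ltl_sat_at sigma g j.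
  apply: (IHg (fun i => (x i).2.1)) => k; first by have /andP[] := xr k.
    by have /and4P[] := xs k.
  by move=> /xd /and3P[].
have IHhi j : tab_val (x j).2.2 <-> ltl_sat_at sigma h j.
  apply: (IHh (fun i => (x i).2.2)) => k; first by have /andP[] := xr k.
    by have /and4P[] := xs k.
  by move=> /xd /and3P[].
have untilS j : (x j).1.1 = tab_val (x j).2.2 || tab_val (x j).2.1 && (x j.+1).1.1.
  by have /and4P[/eqP] := xs j.
split.
  (* The unfolding equation alone allows an until to be postponed forever. Fairness of its bit
     yields a time at which it is not pending; the rest is induction on the distance to that
     time. *)
  have [j ij] : exists2 j, i <= j & ~~ (x j).1.1 || tab_val (x j).2.2.
    apply: (@until_done_fair (fun j => (x j).1.2)
      (fun j => ~~ (x j).1.1 || tab_val (x j).2.2)) => j.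
      by have /and4P[_ /eqP] := xs j.
    by move=> /xd /and3P[].
  rewrite -(subnKC ij); move: (j - i) => {j ij} m; elim: m i => [|m IHm] i.
    rewrite addn0 => /orP[/negPf ->//|/IHhi hi _].
    by exists i; split=> // k /andP[ik /(leq_ltn_trans ik)]; rewrite ltnn.
  rewrite addnS -addSn => /IHm{}IHm; rewrite untilS.
  move=> /orP[/IHhi hi|/andP[/IHgi gi /IHm]].
    by exists i; split=> // k /andP[ik /(leq_ltn_trans ik)]; rewrite ltnn.
  move=> [j [ij hj gj]]; exists j; split=> // [|k /andP[]]; first exact: ltnW.
  by rewrite leq_eqVlt => /predU1P[<-//|ik kj]; apply: gj; rewrite ik.
move=> [j [ij /IHhi hj]]; rewrite -(subnKC ij) in hj *.
move: (j - i) hj => {j ij} m; elim: m i => [|m IHm] i; rewrite untilS.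
  by rewrite addn0 => ->.
rewrite addnS => hj gj; have gi : tab_val (x i).2.1.
  by apply/IHgi/gj; rewrite leqnn ltnS leq_addr.
rewrite gi /=.
rewrite (IHm i.+1) ?orbT // => k /andP[ik kj].
by apply: gj; rewrite ltnW.
Qed.

End Soundness.

(** * The tableau run of the true values *)

Section Completeness.
Variable sigma : computation V.

Fixpoint tab_default (f : ltl V) : tab f :=
  match f return tab f with
  | LTrue => tt
  | LVar _ => true
  | LNot g => tab_default g
  | LOr g h => (tab_default g, tab_default h)
  | LNext g => (true, tab_default g)
  | LUntil g h => (true, true, (tab_default g, tab_default h))
  end.

(* The tableau of the true truth values at time i; the state x only serves to
   update the bits. *)
Fixpoint tab_truth (reset : bool) (i : nat) (f : ltl V) : tab f -> tab f :=
  match f return tab f -> tab f with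
  | LTrue => fun x => x
  | LVar v => fun _ => v \in sigma i
  | LNot g => fun x => @tab_truth reset i g x
  | LOr g h => fun x => (tab_truth reset i x.1, tab_truth reset i x.2)
  | LNext g => fun x => (`[< ltl_sat_at sigma g i.+1 >], tab_truth reset i x.2)
  | LUntil g h => fun x =>
      (`[< ltl_sat_at sigma (LUntil g h) i >],
       [|| ~~ reset && x.1.2, ~~ `[< ltl_sat_at sigma (LUntil g h) i >]
         | `[< ltl_sat_at sigma h i >]],
       (tab_truth reset i x.2.1, tab_truth reset i x.2.2))
  end.

Lemma tab_truth_val (f : ltl V) reset i (x : tab f) :
  tab_val (tab_truth reset i x) = `[< ltl_sat_at sigma f i >].
Proof.
elim: f x => [|v|g IHg|g IHg h IHh|g IHg|g IHg h IHh] x //=.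
- by apply/esym/asboolP.
- by rewrite asboolb.
- by rewrite IHg asbool_neg.
- by rewrite IHg IHh asbool_or.
Qed.

Lemma tab_truth_reads (f : ltl V) reset i (x : tab f) :
  tab_reads (sigma i) (tab_truth reset i x).
Proof.
elim: f x => [|v|g IHg|g IHg h IHh|g IHg|g IHg h IHh] x //=.
all: by rewrite IHg IHh.
Qed.

Lemma until_satE (g h : ltl V) i :
  ltl_sat_at sigma (LUntil g h) i <->
  ltl_sat_at sigma h i \/
  ltl_sat_at sigma g i /\ ltl_sat_at sigma (LUntil g h) i.+1.
Proof.
split=> /= [[j [ij hj gj]]|[hi|[gi [j [ij hj gj]]]]].
- move: ij; rewrite leq_eqVlt => /predU1P[->|ij]; first by left.
  right; split; first by apply: gj; rewrite leqnn.
  by exists j; split=> // k /andP[ik kj]; apply: gj; rewrite ltnW.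
- by exists i; split=> // k /andP[ik /(leq_ltn_trans ik)]; rewrite ltnn.
- exists j; split=> // [|k /andP[]]; first exact: ltnW.
  by rewrite leq_eqVlt => /predU1P[<-//|ik kj]; apply: gj; rewrite ik.
Qed.

Lemma tab_truth_step (f : ltl V) reset reset' i (x : tab f) :
  tab_step reset (tab_truth reset' i x)
    (tab_truth reset i.+1 (tab_truth reset' i x)).
Proof.
elim: f x => [|v|g IHg|g IHg h IHh|g IHg|g IHg h IHh] x //=.
- by rewrite IHg IHh.
- by rewrite tab_truth_val eqxx IHg.
rewrite IHg IHh !tab_truth_val eqxx !andbT -asbool_and -asbool_or.
by apply/eqP; apply: asbool_equiv_eq; exact: until_satE.
Qed.

(** Without resets a bit that is set stays set, and every bit gets set eventually. This excludes a
    run with finitely many resets. *)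
Lemma tab_truth_done (f : ltl V) (x : nat -> tab f) N :
  (forall i, N <= i -> x i.+1 = tab_truth false i.+1 (x i)) ->
  exists M, forall i, M <= i -> tab_done (x i).
Proof.
elim: f x => [|v|g IHg|g IHg h IHh|g IHg|g IHg h IHh] x xS; try by exists 0.
- exact: IHg xS.
- have [|M1 M1P] := IHg (fun i => (x i).1); first by move=> i /xS ->.
  have [|M2 M2P] := IHh (fun i => (x i).2); first by move=> i /xS ->.
  exists (maxn M1 M2) => i; rewrite geq_max => /andP[/M1P d1 /M2P d2].
  by rewrite /= d1.
- by have [|M1 M1P] := IHg (fun i => (x i).2); [move=> i /xS -> | exists M1].
have [|M1 M1P] := IHg (fun i => (x i).2.1); first by move=> i /xS ->.
have [|M2 M2P] := IHh (fun i => (x i).2.2); first by move=> i /xS ->.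
(* If [h] holds at some time after [N], the bit is set there; otherwise the until is false at
   [N.+1], which sets it at once. *)
have [M NM dM] : exists2 M, N <= M & (x M).1.2.
  have [hj|nhj] := pselect (exists2 j, N < j & ltl_sat_at sigma h j).
    have [[|j] // Nj hj'] := hj; exists j.+1; first exact: ltnW.
    by rewrite xS //= (asboolT hj') !orbT.
  exists N.+1 => //; rewrite xS //=.
  rewrite (_ : `[< exists j, _ >] = false) ?orbT //; apply/asboolP => -[j [Nj hj _]].
  by apply: nhj; exists j.
have dM' i : M <= i -> (x i).1.2.
  elim: i => [|i IHi]; first by rewrite leqn0 => /eqP <-.
  rewrite leq_eqVlt => /predU1P[<-//|]; rewrite ltnS => Mi.
  by rewrite xS ?(leq_trans NM) //= IHi.
exists (maxn M (maxn M1 M2)) => i; rewrite !geq_max => /and3P[/dM' d /M1P d1 /M2P d2].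
by rewrite /= d d1.
Qed.

Fixpoint truth_run (f : ltl V) (i : nat) : tab f :=
  if i is j.+1 then tab_truth (tab_done (truth_run f j)) i (truth_run f j)
  else tab_truth true 0 (tab_default f).

Lemma truth_run_done (f : ltl V) :
  infinitely_often (fun i => tab_done (truth_run f i)).
Proof.
move=> N; apply: contrapT => nd.
have dF i : N <= i -> tab_done (truth_run f i) = false.
  by move=> Ni; apply/negP => di; apply: nd; exists i.
have [|M MP] := @tab_truth_done f (truth_run f) N; first by move=> i Ni /=; rewrite dF.
by have := MP _ (leq_maxl M N); rewrite dF // leq_maxr.
Qed.

End Completeness.

(** [None] is the state before any letter is read. The tableau reached by reading a letter describes
    the time of that letter, so runs are shifted by one against the computation. *)
Definition tab_trans (f : ltl V) (q : option (tab f)) (a : {set V})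
    (q' : option (tab f)) : bool :=
  match q, q' with
  | None, Some x' => tab_val x' && tab_reads a x'
  | Some x, Some x' => tab_step (tab_done x) x x' && tab_reads a x'
  | _, None => false
  end.

Definition tab_acc (f : ltl V) (q : option (tab f)) : bool :=
  if q is Some x then tab_done x else false.

Lemma tableau_correct (f : ltl V) (sigma : computation V) :
  ltl_sat sigma f <->
  exists q : nat -> option (tab f),
    [/\ q 0 = None, forall i, tab_trans (q i) (sigma i) (q i.+1) &
        infinitely_often (fun i => tab_acc (q i))].
Proof.
split=> [satf|[q [q_0 qS q_inf]]].
  exists (fun i => if i is j.+1 then Some (truth_run sigma f j) else None).
  split=> // [[|i]|N] /=.
  - by rewrite tab_truth_val tab_truth_reads (asboolT satf).
  (* Splitting [i] exposes the outer [tab_truth] of the source state, the form in which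
     [tab_truth_step] applies. *)
  - by case: i => [|i] /=; rewrite tab_truth_step tab_truth_reads.
  have [i Ni di] := truth_run_done sigma f N.
  by exists i.+1 => //; exact: leqW.
have /choice[x xP] : forall i, exists x, q i.+1 = Some x.
  by move=> i; have := qS i; case: (q i.+1) => [x|]; [exists x|case: (q i)].
have x0 : tab_val (x 0) by have := qS 0; rewrite q_0 xP => /andP[].
have xr i : tab_reads (sigma i) (x i).
  by have := qS i; rewrite xP /tab_trans; case: (q i) => [y|] /andP[].
have xs i : tab_step (tab_done (x i)) (x i) (x i.+1).
  by have := qS i.+1; rewrite !xP => /andP[].
have x_inf : infinitely_often (fun i => tab_done (x i)).
  by move=> N; have [[|i]// Ni] := q_inf N.+1; rewrite xP; exists i.
exact/(tab_sound x_inf xr xs (fun i => id) 0).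
Qed.

End Tableau.

(** * Encodings of assumption trees *)

(* The phases of a branch of an encoded tree: a number is expected (PNum), the
   unary code of a number is being read (PUnary), a valuation is expected
   (PEnv), no present node is below (PDead). *)
Inductive phase := PNum | PUnary | PEnv | PDead.

Definition phase_code (x : phase) : bool * bool :=
  match x with
  | PNum => (false, false)
  | PUnary => (false, true)
  | PEnv => (true, false)
  | PDead => (true, true)
  end.

Definition phase_decode (c : bool * bool) : phase :=
  match c with
  | (false, false) => PNum
  | (false, true) => PUnary
  | (true, false) => PEnv
  | (true, true) => PDead
  end.

Lemma phase_codeK : cancel phase_code phase_decode.
Proof. by case. Qed.

HB.instance Definition _ := Finite.copy phase (can_type phase_codeK).

Section Encoding.
Variables (A : architecture) (p : proc A).
Implicit Types (v : anode p) (w : seq (bdir p)) (t : seq (bdir p) -> label p).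
Implicit Types (T : pred (anode p)) (s : annotation p).

Lemma code_cat v v' : code (v ++ v') = code v ++ code v'.
Proof. by rewrite /code map_cat flatten_cat. Qed.

(** The directions have a prefix code: the first [inl true] ends a number, and a valuation is a
    single letter. *)
Lemma code_dir_inj (d d' : adir p) w w' :
  code_dir d ++ w = code_dir d' ++ w' -> d = d' /\ w = w'.
Proof.
case: d d' => [a|e] [b|e'] /=.
- elim: a b => [|a IHa] [|b] //=; first by case.
  by case=> /IHa[[->] ->].
- by case: a.
- by case: b.
- by case=> -> ->.
Qed.

Lemma code_prefix v v' w :
  code v ++ w = code v' -> exists2 v'', v' = v ++ v'' & w = code v''.
Proof.
elim: v v' => [|d v IHv] [|d' v'] /=.
- by exists [::].
- by exists (d' :: v').
- by rewrite /code /=; case: d => [[|a]|e].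
- rewrite /code /= -catA => /code_dir_inj[<- /IHv[v'' -> ->]].
  by exists v''.
Qed.

Lemma code_inj : injective (@code A p).
Proof.
move=> v v' e; have := @code_prefix v v' [::]; rewrite cats0.
case=> // -[|d v''] ->; first by rewrite cats0.
by case: d => [[|a]|].
Qed.

(** Unfinished unary code can only be continued by a bit; this excludes a valuation in phase
    [PUnary]. *)
Lemma unary_code a w v :
  nseq a.+1 (inl false) ++ w = code v -> exists b w', w = inl b :: w'.
Proof.
elim: a v => [|a IHa] [|[[|b]|e] v] //.
  by rewrite [code _]/= => -[->]; case: b => [|b]; [exists true|exists false]; eexists.
rewrite [code _]/= => -[e]; apply: (IHa (inl b :: v)).
by rewrite /= e.
Qed.

Lemma unary_not_code a v : code v <> nseq a.+1 (inl false).
Proof.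
by move=> e; have [] := @unary_code a [::] v; rewrite ?cats0 // => b [].
Qed.

Lemma alternating_cat b v v' :
  alternating b (v ++ v') =
  alternating b v && alternating (b (+) odd (size v)) v'.
Proof.
elim: v b => [|[a|e] v IHv] b /=; first by rewrite addbF.
  by case: b; rewrite // IHv; case: (odd _).
by case: b; rewrite // IHv; case: (odd _).
Qed.

Lemma number_node_odd v : alternating true v -> number_node v = odd (size v).
Proof.
case/lastP: v => // v d; rewrite -cats1 alternating_cat size_cat addn1 /= => /andP[_].
rewrite /number_node; case: v => [|c v] /=; first by case: d.
by rewrite last_cat /=; case: d => _ /=; rewrite ?negbK ?andbT // => /negPf ->.
Qed.

(** Presence is tested only at codes of nodes. Positions inside a unary code are labelled absent
    although present nodes may lie below them. *)
Definition phase_step (x : phase) (present : bool) (d : bdir p) : phase :=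
  match x, d with
  | PNum, inl b =>
      if present then (if b then PEnv else PUnary) else PDead
  | PUnary, inl b => if b then PEnv else PUnary
  | PEnv, inr _ => if present then PNum else PDead
  | _, _ => PDead
  end.

Definition phase_ok (x : phase) (l : label p) : bool :=
  match x with
  | PNum => l.2 == None
  | PEnv => l.1 == isSome l.2
  | _ => l == (false, None)
  end.

Fixpoint phase_from t (x : phase) w w' : phase :=
  if w' is d :: w'' then
    phase_from t (phase_step x (t w).1 d) (rcons w d) w''
  else x.

Definition phase_at t w : phase := phase_from t PNum [::] w.

Lemma phase_at_rcons t w d :
  phase_at t (rcons w d) = phase_step (phase_at t w) (t w).1 d.
Proof.
rewrite /phase_at -{3}[w]cat0s; move: [::] PNum => w0 x.
elim: w w0 x => [|c w IHw] w0 x /=; first by rewrite cats0.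
by rewrite IHw cat_rcons.
Qed.

Lemma phase_dead t w w' : phase_at t w = PDead -> phase_at t (w ++ w') = PDead.
Proof.
move=> dw; elim/last_ind: w' => [|w' d IHw']; first by rewrite cats0.
by rewrite -rcons_cat phase_at_rcons IHw'.
Qed.

Lemma phase_absent t w w' : phase_at t w != PUnary -> (t w).1 = false ->
  w' != [::] -> phase_at t (w ++ w') = PDead.
Proof.
case: w' => // d w' ph tw _; rewrite -cat_rcons; apply: phase_dead.
by rewrite phase_at_rcons tw; case: (phase_at t w) ph d => // _ [].
Qed.

(** Phase [PDead] is left open here because its meaning refers to the tree; [encoded_dead] supplies
    it. *)
Definition phase_spec (x : phase) w : Prop :=
  match x with
  | PNum => exists v, [/\ w = code v, alternating true v & ~~ odd (size v)]
  | PUnary => exists v a, [/\ w = code v ++ nseq a.+1 (inl false),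
                             alternating true v & ~~ odd (size v)]
  | PEnv => exists v, [/\ w = code v, alternating true v & odd (size v)]
  | PDead => True
  end.

Lemma phase_atP t w : phase_spec (phase_at t w) w.
Proof.
elim/last_ind: w => [|w d]; first by exists [::].
rewrite phase_at_rcons; case: (phase_at t w) => /=.
- move=> [v [-> alt ev]]; case: d => //= b; case: (t _).1 => //=; case: b => /=.
    exists (rcons v (inl 0)); rewrite -!cats1 code_cat alternating_cat alt.
    by rewrite size_cat addn1 /= (negPf ev).
  by exists v, 0; rewrite -cats1.
- move=> [v [a [-> alt ev]]]; case: d => //= -[] /=.
    exists (rcons v (inl a.+1)); rewrite -[rcons v _]cats1 code_cat.
    rewrite alternating_cat alt size_cat addn1 /= (negPf ev); split=> //.
    by rewrite rcons_cat /code /= cats0.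
  exists v, a.+1; split=> //; rewrite rcons_cat; congr (_ ++ _).
  by congr (_ :: _); elim: a => //= a ->.
- move=> [v [-> alt ov]]; case: d => //= e; case: (t _).1 => //=.
  exists (rcons v (inr e)); rewrite -!cats1 code_cat alternating_cat alt.
  by rewrite size_cat addn1 /= ov.
- by case: d.
Qed.

(** The tree and the annotation are read off the labels at codes of nodes; the local checks force
    the tree to be prefix-closed and alternating. *)
Lemma phases_ok_encode t : (forall w, phase_ok (phase_at t w) (t w)) ->
  exists T s, assumption_tree T /\ encodes T s t.
Proof.
move=> tok.
pose T v := (t (code v)).1.
(* The empty output is the default at nodes without an output label. *)
have set0_out : set0 \subset out p := sub0set _.
pose s v := odflt (exist _ set0 set0_out : outval p) (t (code v)).2.
have phT v : T v -> phase_at t (code v) =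
    (if odd (size v) then PEnv else PNum) /\ alternating true v.
  rewrite /T => Tv; have := tok (code v); have := phase_atP t (code v).
  case: (phase_at t _) => /=.
  - by move=> [v' [/code_inj <- -> /negPf ->]].
  - move=> [v' [a [/esym/code_prefix[v'' _ /esym/unary_not_code[]]]]].
  - by move=> [v' [/code_inj <- -> ->]].
  - by move=> _ /eqP e; rewrite e in Tv.
have absent v : ~~ T v -> t (code v) = (false, None).
  rewrite /T; have := tok (code v).
  by case: (phase_at t _); case: (t _) => [[] [o|]].
(* Below an absent [u] every phase would be [PDead], whereas [phT] gives a present node phase [PEnv]
   or [PNum]. *)
have prefT u v : T (u ++ v) -> T u.
  move=> Tuv; apply: contraT => nTu.
  have [v0|nv] := eqVneq v [::]; first by rewrite v0 cats0 (negPf nTu) in Tuv.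
  have [|] := eqVneq (phase_at t (code u)) PUnary.
    move=> phu; have := phase_atP t (code u); rewrite phu.
    by move=> [v' [a [/esym/code_prefix[v'' _ /esym/unary_not_code[]]]]].
  move=> phu; have [] := phT _ Tuv; rewrite code_cat phase_absent //.
  - by case: odd.
  - exact: negPf.
  - by case: v nv {Tuv} => // -[[|a]|e].
exists T, s; split; first by split=> [|v /phT[]].
split=> [v|w nw].
  have [Tv|] := boolP (T v); last exact: absent.
  have [ph alt] := phT _ Tv; rewrite number_node_odd //.
  have := tok (code v); rewrite ph /s; move: Tv; rewrite /T.
  by case: odd; case: (t _) => [[] [o|]].
have := tok w; have := phase_atP t w; case: (phase_at t w) => /=.
- by move=> [v [/nw]].
- by move=> _ /eqP.
- by move=> [v [/nw]].
- by move=> _ /eqP.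
Qed.

Section Encoded.
Variables (T : pred (anode p)) (s : annotation p) (t : seq (bdir p) -> label p).
Hypotheses (treeT : assumption_tree T) (encT : encodes T s t).

(** The step into [PDead] has a wrong kind of direction, contradicting alternation or the shape of
    codes, or it leaves an absent node, contradicting prefix closure. *)
Lemma encoded_dead w w' v :
  phase_at t w = PDead -> w ++ w' = code v -> T v = false.
Proof.
have [prefT altT] := treeT; have [encv _] := encT.
elim/last_ind: w w' => [|w d IHw] w' //.
rewrite phase_at_rcons; have := phase_atP t w; case E: (phase_at t w) => /=.
- move=> [u [wE alt ev]] + cv; move: cv; rewrite wE cat_rcons => /code_prefix.
  move=> [v' vE dE]; rewrite encv /=; case Tu: (T u) => /=.
    case: d dE => [[]|e dE] // _; case: v' => [|[[|a]|e'] v'] // in vE dE *.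
    apply/negP => /altT; rewrite vE alternating_cat /= (negPf ev) /=.
    by rewrite andbF.
  by move=> _; apply/negP; rewrite vE => /prefT; rewrite Tu.
- move=> [u [a [wE alt ev]]]; case: d => [[]|e] // _.
  rewrite wE cat_rcons -catA => /code_prefix[v' _ /unary_code[b [w'' //]]].
- move=> [u [wE alt ov]] + cv; move: cv; rewrite wE cat_rcons => /code_prefix.
  move=> [v' vE dE]; rewrite encv /=; case Tu: (T u) => /=; last first.
    by move=> _; apply/negP; rewrite vE => /prefT; rewrite Tu.
  case: d dE => [b dE|e] // _; case: v' => [|[a|e'] v'] // in vE dE *.
  by apply/negP => /altT; rewrite vE alternating_cat /= ov /= andbF.
- by move=> _ _; rewrite cat_rcons; apply: IHw.
Qed.

Lemma encoded_ok w : phase_ok (phase_at t w) (t w).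
Proof.
have [prefT altT] := treeT; have [encv encw] := encT.
have notcode : (forall v, w = code v -> T v = false) -> t w = (false, None).
  move=> nT; have [[v wE]|nv] := pselect (exists v, w = code v).
    by rewrite wE encv nT.
  by apply: encw => v wE; apply: nv; exists v.
have := phase_atP t w; case E: (phase_at t w) => /=.
- by move=> [v [-> alt /negPf ev]]; rewrite encv number_node_odd // ev andbF.
- move=> [v [a [wE _ _]]]; rewrite notcode // => v'.
  by rewrite wE => /code_prefix[v'' _ /esym/unary_not_code].
- by move=> [v [-> alt ov]]; rewrite encv number_node_odd // ov andbT; case: (T v).
- by move=> _; rewrite notcode // => v; rewrite -[w]cats0; exact: encoded_dead.
Qed.

Lemma phase_node v :
  T v -> phase_at t (code v) = if odd (size v) then PEnv else PNum.
Proof.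
move=> Tv; have := phase_atP t (code v).
case E: (phase_at t (code v)) => /=.
- by move=> [v' [/code_inj <- _ /negPf ->]].
- by move=> [v' [a [/esym/code_prefix[v'' _ /esym/unary_not_code[]]]]].
- by move=> [v' [/code_inj <- _ ->]].
- by rewrite (@encoded_dead (code v) [::] v) ?cats0 in Tv.
Qed.

End Encoded.

End Encoding.

(** * Infinite words spelling paths *)

Lemma mkseqD (E : Type) (w : nat -> E) k m :
  mkseq w (k + m) = mkseq w k ++ mkseq (fun i => w (k + i)) m.
Proof. by rewrite /mkseq iotaD map_cat add0n -{2}[k]addn0 iotaDl -map_comp. Qed.

Lemma mkseq_prefix (E : eqType) (w : nat -> E) k (x y : seq E) :
  mkseq w k = x ++ y -> mkseq w (size x) = x.
Proof.
move=> e; have := congr1 size e; rewrite size_mkseq size_cat => ke.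
by move/eqP: e; rewrite ke mkseqD eqseq_cat ?size_mkseq // => /andP[/eqP].
Qed.

Section Spelling.
Variables (A : architecture) (p : proc A).
Implicit Types (pi : apath p) (v : anode p) (w : nat -> bdir p).

Lemma path_evenS pi i :
  path_even pi i.+1 = path_even pi i ++ [:: inl (pi i).1; inr (pi i).2].
Proof. by rewrite /path_even mkseqS flatten_rcons. Qed.

Lemma path_evenS_odd pi i :
  path_even pi i.+1 = rcons (path_odd pi i) (inr (pi i).2).
Proof. by rewrite path_evenS /path_odd -cat_rcons cats1. Qed.

Lemma size_path_even pi i : size (path_even pi i) = i.*2.
Proof. by elim: i => // i IHi; rewrite path_evenS size_cat IHi addn2. Qed.

Lemma size_path_odd pi i : size (path_odd pi i) = i.*2.+1.
Proof. by rewrite size_rcons size_path_even. Qed.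

Lemma path_even_leq pi i j : i <= j ->
  exists v, path_even pi j = path_even pi i ++ v.
Proof.
move=> /subnKC <-; elim: (j - i) => [|m [v e]].
  by exists [::]; rewrite addn0 cats0.
by rewrite addnS path_evenS e -catA; eexists.
Qed.

Definition path_pos pi i : nat := size (code (path_even pi i)).

(** The number [a] takes [a.+1] bits and the valuation one more direction. *)
Lemma path_posS pi i : path_pos pi i.+1 = path_pos pi i + (pi i).1.+2.
Proof.
rewrite /path_pos path_evenS code_cat size_cat /code /=.
by rewrite size_cat size_rcons size_nseq addn1.
Qed.

Lemma path_pos_ltn pi i j : i < j -> path_pos pi i < path_pos pi j.
Proof.
move: i j; apply: (homo_ltn ltn_trans) => i.
by rewrite path_posS -[ltnLHS]addn0 ltn_add2l.
Qed.

Lemma path_pos_leq pi i j : i <= j -> path_pos pi i <= path_pos pi j.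
Proof. by rewrite leq_eqVlt => /predU1P[->//|/path_pos_ltn/ltnW]. Qed.

Lemma leq_path_pos pi i : i <= path_pos pi i.
Proof. by elim: i => // i IHi; apply: leq_ltn_trans IHi _; exact: path_pos_ltn. Qed.

Lemma path_pos_between pi k :
  exists i, path_pos pi i <= k < path_pos pi i.+1.
Proof.
have ex : exists i, k < path_pos pi i by exists k.+1; exact: leq_path_pos.
case: (ex_minnP ex) => -[|i] // ki min_i; exists i; rewrite ki andbT leqNgt.
by apply/negP => /min_i; rewrite ltnn.
Qed.

Definition spells w pi : Prop :=
  forall i, mkseq w (path_pos pi i) = code (path_even pi i).

Lemma path_word pi : exists w, spells w pi.
Proof.
pose d0 : bdir p := inl true.
have nthE i j k : i <= j -> k < path_pos pi i ->
    nth d0 (code (path_even pi i)) k = nth d0 (code (path_even pi j)) k.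
  by move=> /(path_even_leq pi)[v ->] ki; rewrite code_cat nth_cat ki.
(* The code of [path_even pi k.+1] has more than [k] letters by [leq_path_pos], so the default [d0]
   is never read. *)
exists (fun k => nth d0 (code (path_even pi k.+1)) k) => i.
apply: (@eq_from_nth _ d0); rewrite size_mkseq // => k ki.
rewrite nth_mkseq //; case/orP: (leq_total k.+1 i) => ik.
  exact: nthE ik (leq_path_pos pi k.+1).
exact/esym/nthE.
Qed.

Section InTree.
Variables (T : pred (anode p)) (s : annotation p) (t : seq (bdir p) -> label p).
Hypotheses (treeT : assumption_tree T) (encT : encodes T s t).

(** Recurrence of [PNum] excludes the words that remain in an endless unary code or leave the
    tree. *)
Lemma spelled_path w :
  infinitely_often (fun k => phase_at t (mkseq w k) = PNum) ->
  exists2 pi, spells w pi & path_in T pi.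
Proof.
have [prefT altT] := treeT; have [encv _] := encT => num_inf.
(* The node read at one occurrence of [PNum] is present, since otherwise the later occurrence would
   be in phase [PDead]. *)
have good k : exists m v,
    [/\ k < m, mkseq w m = code v, T v & ~~ odd (size v)].
  have [m km phm] := num_inf k.+1; have [m' mm' phm'] := num_inf m.+1.
  have := phase_atP t (mkseq w m); rewrite phm => -[v [e alt ev]].
  exists m, v; split=> //; apply: contraT => nTv.
  move: phm'; rewrite -(subnKC mm') addSnnS mkseqD phase_absent ?phm //.
  by rewrite e encv (negPf nTv).
have set0_env : set0 \subset ~: out p := sub0set _.
(* For an even node on the word, [f] gives the number and valuation that come next: a longer even
   node on the word, given by [good], starts with them after [v]. *)
have /choice[f fP] : forall v, exists ae : nat * envval p,
    mkseq w (size (code v)) = code v -> ~~ odd (size v) ->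
    let v' := v ++ [:: inl ae.1; inr ae.2] in
    mkseq w (size (code v')) = code v' /\ T v'.
  move=> v; have [[wv ev]|nv] := pselect
    (mkseq w (size (code v)) = code v /\ ~~ odd (size v)); last first.
    by exists (0, exist _ set0 set0_env) => wv ev; case: nv.
  have [m [v' [km wm Tv' ev']]] := good (size (code v)).
  have := wm; rewrite -(subnKC (ltnW km)) mkseqD wv => /code_prefix[v'' v'E rE].
  have := altT _ Tv'; rewrite v'E alternating_cat (negPf ev) => /andP[_].
  move: ev'; rewrite v'E size_cat oddD (negPf ev) /=.
  case: v'' rE v'E => [|[a|e1] [|[b|e2] v3]] //= rE v'E.
    have /eqP := congr1 size rE.
    by rewrite size_mkseq subn_eq0 leqNgt km.
  move=> _ _; exists (a, e2) => _ _ /=.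
  have v'E' : v' = (v ++ [:: inl a; inr e2]) ++ v3 by rewrite -catA.
  split; last by apply: (prefT _ v3); rewrite -v'E'.
  by apply: (@mkseq_prefix _ w m _ (code v3)); rewrite -code_cat -v'E'.
pose vs := fix vs i := if i is j.+1 then
  vs j ++ [:: inl (f (vs j)).1; inr (f (vs j)).2] else [::].
pose pi i := f (vs i).
have piE i : path_even pi i = vs i.
  by elim: i => // i IHi; rewrite path_evenS IHi.
have sp : spells w pi.
  elim=> [//|i IHi]; rewrite /path_pos piE /=.
  have [] := fP (vs i) => //; first by rewrite -piE.
  by rewrite -piE size_path_even odd_double.
have TS i : T (path_even pi i.+1).
  rewrite piE /=; have [] := fP (vs i) => //; first by rewrite -piE; exact: sp.
  by rewrite -piE size_path_even odd_double.
exists pi => // i; split.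
  by apply: (prefT _ [:: inl (pi i).1; inr (pi i).2]); rewrite -path_evenS.
by apply: (prefT _ [:: inr (pi i).2]); rewrite cats1 -path_evenS_odd.
Qed.

Variables (w : nat -> bdir p) (pi : apath p).
Hypotheses (sp : spells w pi) (piT : path_in T pi).

Lemma spelled_unary i j : j <= (pi i).1 ->
  mkseq w (path_pos pi i + j) = code (path_even pi i) ++ nseq j (inl false).
Proof.
move=> ji; set x := RHS.
have -> : path_pos pi i + j = size x by rewrite size_cat size_nseq.
have /= := sp i.+1; rewrite path_evenS code_cat /code /= -/(code _).
rewrite -(subnKC ji) nseqD -cats1 -!catA catA => e.
exact: mkseq_prefix e.
Qed.

(** The number is complete only at offset [(pi i).1.+1]; before that no valuation is expected, so
    [dom_track] keeps the Büchi state. *)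
Lemma spelled_phase_unary i j :
  j <= (pi i).1 -> phase_at t (mkseq w (path_pos pi i + j)) != PEnv.
Proof.
move=> ji; rewrite spelled_unary //; apply/eqP => ph.
have := phase_atP t (code (path_even pi i) ++ nseq j (inl false)).
rewrite ph => -[v [/code_prefix[v' -> e] _]].
case: j e {ji ph} => [|j] /=; last by move=> /esym/unary_not_code.
case: v' => [|[[|a]|e'] v'] // _.
by rewrite cats0 size_path_even odd_double.
Qed.

Lemma spelled_odd i :
  mkseq w (path_pos pi i + (pi i).1.+1) = code (path_odd pi i).
Proof.
have -> : path_pos pi i + (pi i).1.+1 = size (code (path_odd pi i)).
  by rewrite /path_odd -cats1 code_cat size_cat /code /= cats0 size_rcons size_nseq.
have := sp i.+1; rewrite path_evenS_odd -cats1 code_cat => e.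
exact: mkseq_prefix e.
Qed.

Lemma spelled_phase_odd i :
  phase_at t (mkseq w (path_pos pi i + (pi i).1.+1)) = PEnv.
Proof.
rewrite spelled_odd (phase_node treeT encT) ?(piT i).2 //.
by rewrite size_path_odd /= odd_double.
Qed.

Lemma spelled_label i :
  t (mkseq w (path_pos pi i + (pi i).1.+1)) = (true, Some (s (path_odd pi i))).
Proof.
have [_ altT] := treeT; have [encv _] := encT; have [_ To] := piT i.
rewrite spelled_odd encv To number_node_odd ?altT //.
by rewrite size_path_odd /= odd_double.
Qed.

Lemma spelled_env i : w (path_pos pi i + (pi i).1.+1) = inr (pi i).2.
Proof.
have := sp i.+1; rewrite path_posS addnS mkseqS spelled_odd path_evenS_odd.
by rewrite -[rcons (path_odd _ _) _]cats1 code_cat /code /= cats1 => /rcons_inj[].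
Qed.

End InTree.

End Spelling.

(** * Dominance as an LTL property of paths *)

Fixpoint ltl_map (V W : Type) (g : V -> W) (f : ltl V) : ltl W :=
  match f with
  | LTrue => LTrue W
  | LVar v => LVar (g v)
  | LNot f1 => LNot (ltl_map g f1)
  | LOr f1 f2 => LOr (ltl_map g f1) (ltl_map g f2)
  | LNext f1 => LNext (ltl_map g f1)
  | LUntil f1 f2 => LUntil (ltl_map g f1) (ltl_map g f2)
  end.

Lemma ltl_map_sat (V W : finType) (g : V -> W) (sigma : computation W)
    (tau : computation V) (f : ltl V) :
  (forall i v, (g v \in sigma i) = (v \in tau i)) ->
  forall i, ltl_sat_at sigma (ltl_map g f) i <-> ltl_sat_at tau f i.
Proof.
move=> gE; elim: f => [|v|f1 IH1|f1 IH1 f2 IH2|f1 IH1|f1 IH1 f2 IH2] i //=.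
- by rewrite gE.
- by rewrite IH1.
- by rewrite IH1 IH2.
- split=> -[j [ij /IH2 h2 h1]]; exists j; split=> // k /h1.
    by move/IH1.
  by move=> ?; apply/IH1.
Qed.

Section BigConnectives.
Variables (V I : finType) (F : I -> ltl V).

Definition ltl_exists (r : seq I) : ltl V :=
  foldr (fun i f => LOr (F i) f) (LNot (LTrue V)) r.

Definition ltl_forall (r : seq I) : ltl V :=
  foldr (fun i f => LNot (LOr (LNot (F i)) (LNot f))) (LTrue V) r.

Lemma ltl_exists_sat (sigma : computation V) r k :
  ltl_sat_at sigma (ltl_exists r) k <->
  exists2 i, i \in r & ltl_sat_at sigma (F i) k.
Proof.
elim: r => [|i r IHr] /=; first by split=> // -[].
rewrite IHr; split=> [[Fi|[j jr Fj]]|[j]].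
- by exists i; rewrite ?mem_head.
- by exists j; rewrite // inE jr orbT.
- by rewrite inE => /predU1P[->|jr] Fj; [left | right; exists j].
Qed.

Lemma ltl_forall_sat (sigma : computation V) r k :
  ltl_sat_at sigma (ltl_forall r) k <->
  forall i, i \in r -> ltl_sat_at sigma (F i) k.
Proof.
elim: r => [|i r IHr] //=; rewrite -not_andE !notK IHr.
split=> [[Fi Fr] j|Fr]; first by rewrite inE => /predU1P[->|/Fr].
by split=> [|j jr]; apply: Fr; rewrite inE ?eqxx ?jr ?orbT.
Qed.

End BigConnectives.

(* Over the doubled variables, the left copy is the computation of a rival
   annotation and the right copy that of the annotation under test: the rival
   satisfies the conjuncts up to some i, which the other one violates. *)
Definition violation (V : finType) (n : nat) (phi : n.-tuple (ltl V))
    : ltl (V + V)%type :=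
  ltl_exists (fun i : 'I_n =>
    LNot (LOr (LNot (ltl_forall (fun j : 'I_n => ltl_map inl (tnth phi j))
                       [seq j : 'I_n <- enum 'I_n | j <= i]))
              (ltl_map inr (tnth phi i))))
    (enum 'I_n).

Definition join_computations (V : finType) (sigma tau : computation V)
    : computation (V + V)%type :=
  fun i => [set x | match x with
                    | inl v => v \in sigma i
                    | inr v => v \in tau i
                    end].

Lemma violation_sat (V : finType) (n : nat) (phi : n.-tuple (ltl V))
    (sigma tau : computation V) :
  ltl_sat (join_computations sigma tau) (violation phi) <->
  exists2 m, 0 < m <= n & sat_upto phi sigma m /\ ~ sat_upto phi tau m.
Proof.
have sat_l f : ltl_sat_at (join_computations sigma tau) (ltl_map inl f) 0 <->
    ltl_sat sigma f by apply: ltl_map_sat => i v; rewrite inE.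
have sat_r f : ltl_sat_at (join_computations sigma tau) (ltl_map inr f) 0 <->
    ltl_sat tau f by apply: ltl_map_sat => i v; rewrite inE.
rewrite /ltl_sat ltl_exists_sat; split=> /= [[i _]|[m /andP[m0 mn] [sm nsm]]].
  rewrite ltl_forall_sat => /not_orP[/contrapT si nsi]; exists i.+1.
    by rewrite ltn_ord.
  split=> [j ji|ti].
    by apply/sat_l/si; rewrite mem_filter mem_enum andbT.
  by apply: nsi; apply/sat_r/ti.
(* Any violated conjunct below [m] serves: the indices [j <= i] are below [m] too, so the rival
   satisfies them. *)
have [i im nti] : exists2 i : 'I_n, i < m & ~ ltl_sat tau (tnth phi i).
  apply: contrapT => ni; apply: nsm => i im; apply: contrapT => nti.
  by apply: ni; exists i.
exists i; rewrite ?mem_enum // ltl_forall_sat => -[|/sat_r //]; apply=> j.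
rewrite mem_filter => /andP[ji _]; apply/sat_l/sm.
exact: leq_ltn_trans im.
Qed.

Section Dominance.
Variables (A : architecture) (p : proc A) (n : nat).
Variable phi : n.-tuple (ltl (var A)).

(** Both copies share the valuation [e], as the two annotations are compared along the same path. *)
Definition letter (o o' : outval p) (e : envval p) : {set (var A + var A)} :=
  [set x | match x with
           | inl v => v \in val o :|: val e
           | inr v => v \in val o' :|: val e
           end].

(* Distinct nodes of a path have distinct sizes, so along a single path the
   outputs of an annotation are arbitrary. *)
Lemma dominantP (T : pred (anode p)) (s : annotation p) :
  dominant phi T s <->
  forall pi, path_in T pi -> forall o : nat -> outval p,
    ~ ltl_sat (fun i => letter (o i) (s (path_odd pi i)) (pi i).2)
        (violation phi).
Proof.
split=> [dom pi piT o|nviol t pi piT m m_n satm].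
  pose t (v : anode p) := o (size v)./2.
  rewrite [X in ltl_sat X _](_ : _ =
    join_computations (path_computation t pi) (path_computation s pi)).
    move=> /violation_sat[m m_n [satm nsatm]].
    have [n' [/andP[mn' _] satn']] := dom t pi piT m m_n satm.
    by apply: nsatm => i im; apply: satn'; exact: leq_trans mn'.
  apply/funext => i; rewrite /letter /join_computations /path_computation /t.
  by rewrite size_path_odd /= uphalf_double.
exists m; split; first by case/andP: m_n => _ ->; rewrite leqnn.
apply: contrapT => nsatm.
apply: (nviol pi piT (fun i => t (path_odd pi i))).
by apply/(violation_sat phi (path_computation t pi) (path_computation s pi)); exists m.
Qed.

(** * The automaton *)

Let buchi : finType := option (tab (violation phi)).

Definition dom_state : finType := (phase * option buchi)%type.

(* In state (x, Some q) the automaton follows a run of the Büchi automaton of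
   the violation; (x, None) only checks the encoding. *)
Definition dom_track (x : phase) (l : label p) (d : bdir p)
    (b b' : option buchi) : bool :=
  match b, b' with
  | Some q, Some q' =>
      if x == PEnv then
        match l.2, d with
        | Some o', inr e => [exists o, tab_trans q (letter o o' e) q']
        | _, _ => false
        end
      else q == q'
  | None, Some _ => false
  | _, None => true
  end.

Definition dom_next (q : dom_state) (l : label p) (d : bdir p)
    (q' : dom_state) : bool :=
  (q'.1 == phase_step q.1 l.1 d) && dom_track q.1 l d q.2 q'.2.

Definition dom_ok (q : dom_state) (l : label p) : bool := phase_ok q.1 l.

(* Infinite unary codes must not be rejected, hence the restriction to PNum. *)
Definition dom_bad (q : dom_state) : bool :=
  (q.1 == PNum) && (if q.2 is Some b then tab_acc b else false).

Definition dom_init : dom_state := (PNum, Some None).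

Definition dom_automaton : parity_automaton (bdir p) (label p) :=
  univ_automaton dom_init dom_ok dom_next (fun q => dom_bad q : nat).

Variable t : seq (bdir p) -> label p.

Lemma dom_trace_phase tau : trace dom_init dom_next t tau ->
  (trace_state dom_init tau).1 = phase_at t (unzip1 tau).
Proof.
elim/last_ind: tau => // tau [d q'] IHtau.
rewrite trace_rcons => /andP[/IHtau e /andP[/eqP q'E _]].
by rewrite /trace_state /unzip1 /unzip2 !map_rcons last_rcons phase_at_rcons -e.
Qed.

(** Second component [None] is always a permitted successor, so the encoding is checked at every
    position, even where no Büchi run survives. *)
Lemma dom_trace_exists w :
  exists2 tau, trace dom_init dom_next t tau & unzip1 tau = w.
Proof.
elim/last_ind: w => [|w d [tau tr <-]]; first by exists [::].
set q := trace_state dom_init tau.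
exists (rcons tau (d, (phase_step q.1 (t (unzip1 tau)).1 d, None))).
  by rewrite trace_rcons tr /dom_next eqxx /=; case: q.2.
by rewrite /unzip1 map_rcons.
Qed.

Lemma dom_traces_ok :
  (forall tau, trace dom_init dom_next t tau ->
     dom_ok (trace_state dom_init tau) (t (unzip1 tau))) <->
  (forall w, phase_ok (phase_at t w) (t w)).
Proof.
split=> [ok w|ok tau tr].
  have [tau tr <-] := dom_trace_exists w.
  by rewrite -dom_trace_phase //; exact: ok.
by rewrite /dom_ok dom_trace_phase.
Qed.

Lemma dom_infinite_phase w q : infinite_trace dom_init dom_next t w q ->
  forall k, (q k).1 = phase_at t (mkseq w k).
Proof.
move=> [q_0 qS]; elim=> [|k IHk]; first by rewrite q_0.
by have /andP[/eqP -> _] := qS k; rewrite IHk mkseqS phase_at_rcons.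
Qed.

Section Encoded.
Variables (T : pred (anode p)) (s : annotation p).
Hypotheses (treeT : assumption_tree T) (encT : encodes T s t).

Definition path_letter (pi : apath p) (o : nat -> outval p) i :=
  letter (o i) (s (path_odd pi i)) (pi i).2.

Lemma violation_trace pi o : path_in T pi ->
  ltl_sat (path_letter pi o) (violation phi) ->
  exists w q, infinite_trace dom_init dom_next t w q /\
    infinitely_often (fun k => dom_bad (q k)).
Proof.
move=> piT /tableau_correct[b [b_0 bS b_inf]].
have [w sp] := path_word pi.
(* [idx k] is the step of the path to which position [k] of the word belongs; the Büchi run advances
   once per step, on the valuation. *)
have /choice[idx idxP] := path_pos_between pi.
have idxE k i : path_pos pi i <= k < path_pos pi i.+1 -> idx k = i.
  move=> /andP[ik ki]; have /andP[jk kj] := idxP k.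
  apply/eqP; rewrite eqn_leq; apply/andP; split; rewrite leqNgt; apply/negP.
    by move=> /(path_pos_leq pi) /(leq_trans ki); rewrite ltnNge jk.
  by move=> /(path_pos_leq pi) /(leq_trans kj); rewrite ltnNge ik.
have idx_pos i : idx (path_pos pi i) = i by rewrite (idxE _ i) // leqnn path_pos_ltn.
exists w, (fun k => (phase_at t (mkseq w k), Some (b (idx k)))); split.
  split=> [|k]; first by rewrite -[0]/(path_pos pi 0) idx_pos b_0.
  rewrite /dom_next /= mkseqS phase_at_rcons eqxx /=.
  have /andP[ik ki] := idxP k; set i := idx k in ik ki *.
  have kE := subnKC ik; move: (k - path_pos pi i) kE => j kE.
  (* The offset [j] either is that of the valuation, where the Büchi automaton moves, or lies within
     the number, where its state is kept. *)
  move: (ki); rewrite path_posS -kE ltn_add2l ltnS leq_eqVlt ltnS => /predU1P[jE|ji].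
    have -> : idx (path_pos pi i + j).+1 = i.+1.
      by rewrite -addnS jE -path_posS idx_pos.
    rewrite jE (spelled_phase_odd treeT encT sp piT) eqxx.
    rewrite (spelled_label treeT encT sp piT) (spelled_env sp) /=.
    by apply/existsP; exists (o i); exact: bS.
  rewrite (negPf (spelled_phase_unary _ sp ji)) (idxE _ i) //.
  by rewrite -addnS leq_addr path_posS ltn_add2l !ltnS.
move=> N; have [i Ni bi] := b_inf N; exists (path_pos pi i).
  exact: leq_trans (leq_path_pos pi i).
rewrite /dom_bad /= idx_pos bi andbT sp (phase_node treeT encT) ?(piT i).1 //.
by rewrite size_path_even odd_double.
Qed.

Lemma trace_violation w q : infinite_trace dom_init dom_next t w q ->
  infinitely_often (fun k => dom_bad (q k)) ->
  exists pi o, path_in T pi /\ ltl_sat (path_letter pi o) (violation phi).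
Proof.
move=> qtr bad_inf; have qph := dom_infinite_phase qtr; have [q_0 qS] := qtr.
have [pi sp piT] : exists2 pi, spells w pi & path_in T pi.
  apply: (spelled_path treeT encT) => N; have [k Nk /andP[/eqP ph _]] := bad_inf N.
  by exists k; rewrite // -qph.
(* A second component [None] persists and is never bad, so it cannot occur on this trace. *)
have /choice[b bE] : forall k, exists b, (q k).2 = Some b.
  move=> k; case E: (q k).2 => [b|]; first by exists b.
  have none m : (q (k + m)).2 = None.
    elim: m => [|m IHm]; first by rewrite addn0.
    have /andP[_] := qS (k + m); rewrite addnS IHm /=.
    by case: (q _.+1).2.
  have [m km /andP[_]] := bad_inf k.
  by rewrite -(subnKC km) none.
have b_const i j : j <= (pi i).1.+1 -> b (path_pos pi i + j) = b (path_pos pi i).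
  elim: j => [|j IHj] ji; first by rewrite addn0.
  have /andP[_] := qS (path_pos pi i + j).
  rewrite /dom_track addnS !bE qph (negPf (spelled_phase_unary _ sp ji)) => /eqP <-.
  exact/IHj/ltnW.
have /choice[o oP] : forall i, exists o, tab_trans (b (path_pos pi i))
    (letter o (s (path_odd pi i)) (pi i).2) (b (path_pos pi i.+1)).
  move=> i; have /andP[_] := qS (path_pos pi i + (pi i).1.+1).
  rewrite /dom_track -addnS -path_posS !bE qph (spelled_phase_odd treeT encT sp piT).
  rewrite (spelled_label treeT encT sp piT) (spelled_env sp) /= b_const //.
  by move=> /existsP.
exists pi, o; split=> //; apply/tableau_correct.
exists (fun i => b (path_pos pi i)); split=> //.
  by have := bE 0; rewrite q_0 => -[].
(* A bad position beyond the start of step [N] belongs to some step [i >= N], throughout which the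
   Büchi state is constant. *)
move=> N; have [k Nk /andP[_]] := bad_inf (path_pos pi N); rewrite bE => bk.
have [i /andP[ik ki]] := path_pos_between pi k; exists i.
  rewrite leqNgt; apply/negP => /(path_pos_leq pi) /(leq_trans ki).
  by rewrite ltnNge Nk.
rewrite -(@b_const i (k - path_pos pi i)) ?subnKC //.
by rewrite leq_subLR -ltnS -addnS -path_posS.
Qed.

(** Traces with infinitely many bad states correspond to paths of the tree with rival outputs that
    produce a violation. *)
Lemma dom_accepts_encoded : accepts dom_automaton t <-> dominant phi T s.
Proof.
split=> [acc|dom].
  apply/dominantP => pi piT o /(violation_trace piT)[w [q [qtr bad_inf]]].
  by have /parity_bool := accepts_traces_parity acc qtr; apply.
apply: traces_accepts; first by apply/dom_traces_ok => w; exact: encoded_ok encT w.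
move=> w q qtr; apply/parity_bool => /(trace_violation qtr)[pi [o [piT]]].
by move/dominantP: dom => /(_ pi piT o).
Qed.

End Encoded.

End Dominance.

Theorem theorem2 (A : architecture) (p : proc A) (n : nat) (n_gt0 : 0 < n)
    (phi : n.-tuple (ltl (var A))) :
  { M : parity_automaton (bdir p) (label p) |
    forall t : seq (bdir p) -> label p,
      accepts M t <->
      exists (T : pred (anode p)) (s : annotation p),
        [/\ assumption_tree T, dominant phi T s & encodes T s t] }.
Proof.
exists (dom_automaton p phi) => t; split=> [acc|[T [s [treeT dom encT]]]].
  (* The local checks first recover a tree and an annotation, for which acceptance then means
     dominance. *)
  have /dom_traces_ok/phases_ok_encode[T [s [treeT encT]]] := accepts_traces_ok acc.
  by exists T, s; split=> //; apply/(dom_accepts_encoded phi treeT encT).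
exact/(dom_accepts_encoded phi treeT encT).
Qed.
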